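(* Consider the perturbed mechanical system $$\dot q=\nabla_{\mathbf p}H(q,\mathbf p),\qquad \dot{\mathbf p}=-\nabla_q H(q,\mathbf p)-\mathfrak R\,\nabla_{\mathbf p}H(q,\mathbf p)+G(q)u+d,\qquad H(q,\mathbf p)=\tfrac12\mathbf p^\top M^{-1}(q)\mathbf p+V(q),$$ with $q,\mathbf p\in\mathbb R^n$, $u\in\mathbb R^m$, unknown constant disturbance $d\in\mathbb R^n$ and friction matrix $\mathfrak R=\mathrm{diag}\{r_1,\dots,r_n\}$, $r_i\ge 0$, where the coefficients $r_i$ with $i\in\kappa=\{\kappa_1<\dots<\kappa_s\}\subset\{1,\dots,n\}$ are unknown and the remaining ones are known. Assume that $M^{-1}(q)$ admits a factorization $M^{-1}(q)=T(q)T^\top(q)$, with $T:\mathbb R^n\to\mathbb R^{n\times n}$ of full rank, such that: (1) the columns $(T)_1,\dots,(T)_n$ of $T$, viewed as vector fields on $\mathbb R^n$, satisfy $[(T)_i,(T)_j]=0$ for all $i,j\in\{1,\dots,n\}$, where $[\cdot,\cdot]$ is the Lie bracket; (2) for every $i\in\kappa$, the $i$-th row of $T(q)$ is independent of $q$. Let $Q:\mathbb R^n\to\mathbb R^n$ be a mapping with Jacobian $\nabla Q(q)=T^{-1}(q)$ (which exists by (1)), and let $\lambda>0$ be a free parameter. Consider the $(2n+s)$-dimensional adaptive momenta observer with state $(p_I,r_{u_I},d_I)\in\mathbb R^n\times\mathbb R^s\times\mathbb R^n$, $$\begin{aligned} \dot p_I&=-T^\top(q)\big[\nabla V(q)-G(q)u-\hat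 d\,\big]-\Big(\sum_{i=1}^nY_i\hat p_i\Big)\hat r_u-\big[\lambda I_n+R_k(q)\big]\hat p,\\ \dot r_{u_I}&=\frac1\lambda\Big(\sum_{i=1}^nY_i^\top\hat p_i\Big)\big(\dot p_I+\lambda\hat p\big),\\ \dot d_I&=-T(q)\hat p,\\ \hat p&=p_I+\lambda Q(q),\\ \hat r_u&=r_{u_I}-\frac1{2\lambda}\sum_{i=1}^s\big(\hat p^\top L_{\kappa_i}\hat p\big)\,e_i,\\ \hat d&=d_I+q,\\ \hat{\mathbf p}&=T^{-\top}(q)\hat p, \end{aligned}$$ where $\hat p=\mathrm{col}(\hat p_1,\dots,\hat p_n)$, $e_i$ in the formula for $\hat r_u$ is the $i$-th Euclidean basis vector of $\mathbb R^s$, and the matrices $R_k(q)\in\mathbb R^{n\times n}$, $Y_j\in\mathbb R^{n\times s}$, $L_i\in\mathbb R^{n\times n}$ are as defined in the context. Then, for all initial conditions $(q(0),\mathbf p(0))\in\mathbb R^n\times\mathbb R^n$ (and any initial observer state), the observer ensures boundedness of all signals and $$\lim_{t\to\infty}\big[\hat{\mathbf p}(t)-\mathbf p(t)\big]=0.$$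
   Context: $M:\mathbb R^n\to\mathbb R^{n\times n}$ is the inertia matrix, $M(q)=M^\top(q)>0$ for all $q$; $V:\mathbb R^n\to\mathbb R$ is the potential energy; $G:\mathbb R^n\to\mathbb R^{n\times m}$ is the input matrix. $M,V,G$ and $T$ are smooth. The input $u(t)$ is assumed to be such that the trajectories of the system exist for all $t\ge0$. The signals $q$ and $u$ are available to the observer; $\mathbf p$, $d$ and $r_i$, $i\in\kappa$, are not. Notation: $\mathrm{col}(\cdot)$ denotes a column vector; $I_n$ is the $n\times n$ identity; $T^{-\top}=(T^{-1})^\top$; for $g:\mathbb R^n\to\mathbb R^n$, $\nabla g$ is the Jacobian matrix, and for scalar functions $\nabla$ denotes the (column) gradient. Friction: $\mathfrak R=\mathfrak R_k+\mathfrak R_u$, where $\mathfrak R_k$ and $\mathfrak R_u$ are the diagonal $n\times n$ matrices containing, respectively, the known and the unknown friction coefficients (zeros elsewhere on the diagonal), so the $i$-th diagonal entry of $\mathfrak R_u$ is $r_i$ if $i\in\kappa$ and $0$ otherwise. $R_k(q):=T^\top(q)\mathfrak R_kT(q)$. The vector of unknown coefficients is $r_u=\mathrm{col}(r_{\kappa_1},\dots,r_{\kappa_s})\in\mathbb R^s$, and $C\in\mathbb R^{n\times s}$ is the matrix whose $j$-th column is the basis vector $e_{\kappa_j}$ of $\mathbb R^n$, so that $C^\top\mathrm{col}(r_1,\dots,r_n)=r_u$. With $e_1,\dots,e_n$ the Euclidean basis of $\mathbb R^n$, define $$L_i:=T^\top(q)e_ie_i^\top T(q),\quad i\in\{1,\dots,n\},\qquad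 Y_j:=\sum_{i=1}^nT^\top(q)e_ie_i^\top T(q)\,e_j\,e_i^\top C,\quad j\in\{1,\dots,n\}.$$ By assumption (2), the $L_i$ with $i\in\kappa$ and all $Y_j$ are constant (independent of $q$).
   Formalization: Without further assumptions the claim is false, so boundedness of all signals is proved assuming q and 𝐩 bounded, and the limit assuming T(q(t)), its inverse and 𝐩(t) bounded; the estimation errors are bounded unconditionally; observer solutions are taken to exist for all t≥0. *)

(* Defs.v *)
From HB Require Import structures.
From mathcomp Require Import all_boot all_order all_algebra.
From mathcomp Require Import all_classical all_reals all_analysis.

Set Implicit Arguments.
Unset Strict Implicit.
Unset Printing Implicit Defensive.

Import Order.TTheory GRing.Theory Num.Theory.
Import numFieldNormedType.Exports.

Local Open Scope classical_set_scope.
Local Open Scope ring_scope.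

Section calculus.
Context {R : realType}.

Fixpoint Ck {V W : normedModType R} (k : nat) (f : V -> W) : Prop :=
  if k is k'.+1 then
    (forall x, differentiable f x) /\ (forall v, Ck k' (fun x => 'D_v f x))
  else continuous f.

Definition smooth {V W : normedModType R} (f : V -> W) := forall k, Ck k f.

Definition ebasis {n : nat} (i : 'I_n) : 'cV[R]_n := delta_mx i 0.

Definition gradient {n : nat} (f : 'cV[R]_n -> R) (x : 'cV[R]_n) : 'cV[R]_n :=
  \col_i 'D_(ebasis i) f x.

(* The (i, j) entry is the partial derivative of g_i along x_j. *)
Definition Jacobian {n k : nat} (g : 'cV[R]_n -> 'cV[R]_k) (x : 'cV[R]_n) :
    'M[R]_(k, n) :=
  \matrix_(i, j) ('D_(ebasis j) g x) i 0.

Definition Lie_bracket {n : nat} (f g : 'cV[R]_n -> 'cV[R]_n) (x : 'cV[R]_n) :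
    'cV[R]_n :=
  Jacobian g x *m f x - Jacobian f x *m g x.

Definition posdefmx {n : nat} (A : 'M[R]_n) :=
  A^T = A /\ forall x : 'cV[R]_n, x != 0 -> 0 < (x^T *m A *m x) 0 0.

(* Classical solution on [0, +oo[ of x' = rhs: continuous up to t = 0, where no
   two-sided derivative is required. *)
Definition solves {n : nat} (x rhs : R -> 'cV[R]_n) :=
  {within `[0, +oo[, continuous x} /\
  forall t : R, 0 < t -> is_derive t 1 x (rhs t).

Definition bounded_signal {W : normedModType R} (x : R -> W) :=
  [bounded x t | t in `[0, +oo[].

End calculus.

Section mechanical_system.
Context {R : realType} {n m : nat}.
Variables (M : 'cV[R]_n -> 'M[R]_n) (V : 'cV[R]_n -> R)
  (G : 'cV[R]_n -> 'M[R]_(n, m)).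

Definition Hamiltonian (q p : 'cV[R]_n) : R :=
  2^-1 * (p^T *m invmx (M q) *m p) 0 0 + V q.

Definition gradH_q (q p : 'cV[R]_n) := gradient (fun x => Hamiltonian x p) q.
Definition gradH_p (q p : 'cV[R]_n) := gradient (fun x => Hamiltonian q x) p.

Definition system_trajectory (r d : 'cV[R]_n) (u : R -> 'cV[R]_m)
    (q p : R -> 'cV[R]_n) :=
  solves q (fun t => gradH_p (q t) (p t)) /\
  solves p (fun t => - gradH_q (q t) (p t)
                     - diag_mx r^T *m gradH_p (q t) (p t)
                     + G (q t) *m u t + d).

End mechanical_system.

Section observer.
Context {R : realType} {n m s : nat}.
Variable kappa : 'I_s -> 'I_n.

Definition Rfrak_k (r : 'cV[R]_n) : 'M[R]_n :=
  diag_mx (\row_i (if i \in codom kappa then 0 else r i 0)).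

Definition C_mx : 'M[R]_(n, s) := \matrix_(i, j) ebasis (kappa j) i 0.

Definition r_unknown (r : 'cV[R]_n) : 'cV[R]_s := C_mx^T *m r.

(* In the next three definitions A stands for the value T(q). *)
Definition R_k (r : 'cV[R]_n) (A : 'M[R]_n) : 'M[R]_n :=
  A^T *m Rfrak_k r *m A.

Definition L_mx (A : 'M[R]_n) (i : 'I_n) : 'M[R]_n :=
  A^T *m ebasis i *m (ebasis i)^T *m A.

Definition Y_mx (A : 'M[R]_n) (j : 'I_n) : 'M[R]_(n, s) :=
  \sum_(i < n) A^T *m ebasis i *m (ebasis i)^T *m A *m ebasis j
               *m (ebasis i)^T *m C_mx.

Variables (V : 'cV[R]_n -> R) (G : 'cV[R]_n -> 'M[R]_(n, m))
  (T : 'cV[R]_n -> 'M[R]_n) (Q : 'cV[R]_n -> 'cV[R]_n)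
  (lambda : R) (r : 'cV[R]_n).

Definition p_hat (q pI : 'cV[R]_n) : 'cV[R]_n := pI + lambda *: Q q.

Definition ru_hat (q pI : 'cV[R]_n) (rI : 'cV[R]_s) : 'cV[R]_s :=
  rI - (2 * lambda)^-1 *: \sum_(i < s)
         (((p_hat q pI)^T *m L_mx (T q) (kappa i) *m p_hat q pI) 0 0
            *: ebasis i).

Definition d_hat (q dI : 'cV[R]_n) : 'cV[R]_n := dI + q.

Definition bp_hat (q pI : 'cV[R]_n) : 'cV[R]_n :=
  (invmx (T q))^T *m p_hat q pI.

Definition pI_rhs (u : 'cV[R]_m) (q pI : 'cV[R]_n) (rI : 'cV[R]_s)
    (dI : 'cV[R]_n) : 'cV[R]_n :=
  - ((T q)^T *m (gradient V q - G q *m u - d_hat q dI))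
  - (\sum_(i < n) p_hat q pI i 0 *: Y_mx (T q) i) *m ru_hat q pI rI
  - (lambda%:M + R_k r (T q)) *m p_hat q pI.

Definition rI_rhs (u : 'cV[R]_m) (q pI : 'cV[R]_n) (rI : 'cV[R]_s)
    (dI : 'cV[R]_n) : 'cV[R]_s :=
  lambda^-1 *: ((\sum_(i < n) p_hat q pI i 0 *: (Y_mx (T q) i)^T)
                *m (pI_rhs u q pI rI dI + lambda *: p_hat q pI)).

Definition dI_rhs (q pI : 'cV[R]_n) : 'cV[R]_n := - (T q *m p_hat q pI).

(* r enters only through R_k, i.e. through its known coefficients. *)
Definition observer_trajectory (u : R -> 'cV[R]_m) (q pI : R -> 'cV[R]_n)
    (rI : R -> 'cV[R]_s) (dI : R -> 'cV[R]_n) :=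
  [/\ solves pI (fun t => pI_rhs (u t) (q t) (pI t) (rI t) (dI t)),
      solves rI (fun t => rI_rhs (u t) (q t) (pI t) (rI t) (dI t))
    & solves dI (fun t => dI_rhs (q t) (pI t))].

End observer.

(* Main.v *)
Require Import Defs.
From HB Require Import structures.
From mathcomp Require Import all_boot all_order all_algebra.
From mathcomp Require Import all_classical all_reals all_analysis.
From mathcomp Require Import ring lra.

Set Implicit Arguments.
Unset Strict Implicit.
Unset Printing Implicit Defensive.

Import Order.TTheory GRing.Theory Num.Theory.
Import numFieldNormedType.Exports.

Local Open Scope classical_set_scope.
Local Open Scope ring_scope.

(* Write [P := T^T p], so that [q' = T P]. Differentiating [P] produces the
   quadratic terms [(D_(T P) T)^T p] and [T^T grad_q (|T^T p|^2 / 2)]; they cancel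
   exactly because the columns of [T] commute, hence
   [P' = - T^T (grad V - G u - d) - T^T R T P].
   Condition (2) says that [B := C^T T(q)] is constant, and
   [sum_i v_i Y_i = B^T diag (B v)]. With [Y := B^T diag (B p_hat)] the errors
   [x := p_hat - P], [y := r_hat - r_u], [z := d_hat - d] then satisfy
     [x' = T^T z - lambda x - T^T R T x - Y y], [y' = Y^T x], [z' = - T x],
   so [|x|^2 + |y|^2 + |z|^2] has derivative at most [- 2 lambda |x|^2]. This
   bounds the errors, and a Barbalat argument gives [x --> 0]. *)

(** * Norms, limits and derivatives of matrix-valued functions *)

Section matrix_calculus.
Context {R : realType}.

(** [0 <= c] covers matrices without entries, whose norm is [0]. *)
Lemma norm_mx_le {m n} (A : 'M[R]_(m, n)) (c : R) :
  0 <= c -> (forall i j, `|A i j| <= c) -> `|A| <= c.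
Proof.
move=> c0 h; rewrite [leLHS]/Num.Def.normr/= mx_normrE.
by apply: bigmax_le => // -[i j] _; exact: h.
Qed.

Lemma norm_entry_le {m n} (A : 'M[R]_(m, n)) i j : `|A i j| <= `|A|.
Proof.
rewrite [leRHS]/Num.Def.normr/= mx_normrE.
exact: (le_bigmax _ (fun ij => `|A ij.1 ij.2|) (i, j)).
Qed.

Lemma norm_trmx {m n} (A : 'M[R]_(m, n)) : `|A^T| = `|A|.
Proof.
apply/eqP; rewrite eq_le; apply/andP; split; apply: norm_mx_le => // i j.
  by rewrite mxE norm_entry_le.
by have := norm_entry_le A^T j i; rewrite mxE.
Qed.

Lemma norm_mulmx_le {m n k} (A : 'M[R]_(m, n)) (B : 'M[R]_(n, k)) :
  `|A *m B| <= n%:R * (`|A| * `|B|).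
Proof.
apply: norm_mx_le => [|i j]; first by rewrite !mulr_ge0.
rewrite mxE (le_trans (ler_norm_sum _ _ _))//.
have -> : n%:R * (`|A| * `|B|) = \sum_(l < n) `|A| * `|B|.
  by rewrite sumr_const card_ord mulr_natl.
apply: ler_sum => l _.
by rewrite normrM ler_pM// norm_entry_le.
Qed.

(** The norm is the maximum of finitely many entries, so the entrywise conditions hold together
    eventually. A general filter serves both continuity at a point and continuity within [[0,
    +oo[]. *)
Lemma cvg_mx {m n} {X : Type} {F : set_system X} {FF : Filter F}
    (A : X -> 'M[R]_(m, n)) (a : 'M[R]_(m, n)) :
  (forall i j, A x i j @[x --> F] --> a i j) -> A @ F --> a.
Proof.
move=> h; apply/cvgrPdist_le => /= e e0; near=> x.
apply: norm_mx_le => [|i j]; first exact: ltW.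
rewrite !mxE.
move: i j; near: x; apply: filter_forall => i; apply: filter_forall => j.
exact: ((cvgrPdist_le _ _).1 (h i j)).
Unshelve. all: by end_near. Qed.

Lemma cvg_entry {m n} {X : Type} {F : set_system X} {FF : Filter F}
    (A : X -> 'M[R]_(m, n)) (a : 'M[R]_(m, n)) i j :
  A @ F --> a -> A x i j @[x --> F] --> a i j.
Proof.
by move=> Aa; exact: (cvg_comp _ _ Aa (@coord_continuous _ _ _ i j a)).
Qed.

Lemma cvg_mulmx {m n k} {X : Type} {F : set_system X} {FF : Filter F}
    (A : X -> 'M[R]_(m, n)) (B : X -> 'M[R]_(n, k))
    (a : 'M[R]_(m, n)) (b : 'M[R]_(n, k)) :
  A @ F --> a -> B @ F --> b -> A x *m B x @[x --> F] --> a *m b.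
Proof.
move=> Aa Bb; apply: cvg_mx => i j; rewrite mxE.
under eq_fun do rewrite mxE.
apply: cvg_big => [|l _]; first exact: add_continuous.
by apply: cvgM; exact: cvg_entry.
Qed.

Lemma cvg_trmx {m n} {X : Type} {F : set_system X} {FF : Filter F}
    (A : X -> 'M[R]_(m, n)) (a : 'M[R]_(m, n)) :
  A @ F --> a -> (A x)^T @[x --> F] --> a^T.
Proof.
move=> Aa; apply: cvg_mx => i j; rewrite mxE; under eq_fun do rewrite mxE.
exact: cvg_entry.
Qed.

Lemma is_derive_mxP {V : normedModType R} {m n} (A : V -> 'M[R]_(m, n))
    (x v : V) dA :
  is_derive x v A dA <-> forall i j, is_derive x v (fun y => A y i j) (dA i j).
Proof.
split=> [[dA1 <-] i j|h].
  rewrite derive_mx// mxE; apply: derivableP.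
  by move: i j; apply/derivable_mxP.
have dA1 : derivable A x v by apply/derivable_mxP => i j; case: (h i j).
apply: DeriveDef => //; rewrite derive_mx//; apply/matrixP => i j.
by rewrite mxE; case: (h i j).
Qed.

Lemma is_derive_mulmx {V : normedModType R} {m n k} (A : V -> 'M[R]_(m, n))
    (B : V -> 'M[R]_(n, k)) (x v : V) dA dB :
  is_derive x v A dA -> is_derive x v B dB ->
  is_derive x v (fun y => A y *m B y) (dA *m B x + A x *m dB).
Proof.
move=> /is_derive_mxP hA /is_derive_mxP hB; apply/is_derive_mxP => i j.
have -> : (fun y => (A y *m B y) i j) =
    \sum_l ((fun y => A y i l) * (fun y => B y l j)).
  by apply/funext => y; rewrite fct_sumE mxE.
have -> : (dA *m B x + A x *m dB) i j =
    \sum_l (A x i l *: dB l j + B x l j *: dA i l).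
  rewrite !mxE -big_split/=; apply: eq_bigr => l _.
  by rewrite addrC [B x l j *: _]mulrC.
by apply: is_derive_sum => l; apply: is_deriveM.
Qed.

Lemma is_derive_trmx {V : normedModType R} {m n} (A : V -> 'M[R]_(m, n))
    (x v : V) dA :
  is_derive x v A dA -> is_derive x v (fun y => (A y)^T) dA^T.
Proof.
move=> /is_derive_mxP hA; apply/is_derive_mxP => i j; rewrite mxE.
by under eq_fun do rewrite mxE; exact: hA.
Qed.

Lemma differentiable_is_derive {V W : normedModType R} (f : V -> W) x v :
  differentiable f x -> is_derive x v f ('D_v f x).
Proof. by move=> df; apply/derivableP/diff_derivable. Qed.

(** On the real line derivability is differentiability, so this is the chain rule for differentials
    evaluated at the unit direction. *)
Lemma is_derive_chain {V W : normedModType R} (f : V -> W) (x : R -> V) t dx :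
  differentiable f (x t) -> is_derive t 1 x dx ->
  is_derive t 1 (fun s => f (x s)) ('D_dx f (x t)).
Proof.
move=> df [dx1 <-].
have dxt : differentiable x t by apply/derivable1_diffP.
have dfx : differentiable (f \o x) t by exact: differentiable_comp.
apply: DeriveDef; first exact/derivable1_diffP.
by rewrite deriveE// diff_comp//= !deriveE.
Qed.

Lemma is_deriveD_fun {V W : normedModType R} (f g : V -> W) (x v : V) df dg :
  is_derive x v f df -> is_derive x v g dg ->
  is_derive x v (fun y => f y + g y) (df + dg).
Proof. exact: is_deriveD. Qed.

Lemma is_deriveB_fun {V W : normedModType R} (f g : V -> W) (x v : V) df dg :
  is_derive x v f df -> is_derive x v g dg ->
  is_derive x v (fun y => f y - g y) (df - dg).
Proof. exact: is_deriveB. Qed.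

Lemma is_deriveZ_fun {V W : normedModType R} (f : V -> W) (c : R) (x v : V) df :
  is_derive x v f df -> is_derive x v (fun y => c *: f y) (c *: df).
Proof. exact: is_deriveZ. Qed.

(** Linearity of the differential; this is what ties [gradient] and [Jacobian], built from partial
    derivatives, to directional derivatives. *)
Lemma derive_ebasis {n} {W : normedModType R} (f : 'cV[R]_n -> W) x v :
  differentiable f x -> 'D_v f x = \sum_k v k 0 *: 'D_(ebasis k) f x.
Proof.
move=> df; rewrite deriveE//.
have {1}-> : v = \sum_k v k 0 *: ebasis k.
  by rewrite [LHS]matrix_sum_delta; apply: eq_bigr => i _; rewrite big_ord1.
by rewrite linear_sum; apply: eq_bigr => k _; rewrite linearZ deriveE.
Qed.

Lemma Jacobian_mulmx {n k} (g : 'cV[R]_n -> 'cV[R]_k) x v :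
  differentiable g x -> Jacobian g x *m v = 'D_v g x.
Proof.
move=> dg; rewrite derive_ebasis//; apply/colP => i.
by rewrite mxE summxE; apply: eq_bigr => j _; rewrite !mxE mulrC.
Qed.

Lemma trmx_mul_gradient {n} (f : 'cV[R]_n -> R) x v :
  differentiable f x -> (v^T *m gradient f x) 0 0 = 'D_v f x.
Proof.
by move=> df; rewrite derive_ebasis// mxE; apply: eq_bigr => j _; rewrite !mxE.
Qed.

End matrix_calculus.

(** * The squared Euclidean norm *)

Section euclidean_square.
Context {R : realType}.

Definition sqn {n} (x : 'cV[R]_n) : R := (x^T *m x) 0 0.

Lemma dotmxC {n} (x y : 'cV[R]_n) : (x^T *m y) 0 0 = (y^T *m x) 0 0.
Proof. by rewrite !mxE; apply: eq_bigr => i _; rewrite !mxE mulrC. Qed.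

Lemma sqnE {n} (x : 'cV[R]_n) : sqn x = \sum_i x i 0 ^+ 2.
Proof. by rewrite /sqn mxE; apply: eq_bigr => i _; rewrite mxE expr2. Qed.

Lemma sqn_ge0 {n} (x : 'cV[R]_n) : 0 <= sqn x.
Proof. by rewrite sqnE sumr_ge0// => i _; rewrite sqr_ge0. Qed.

(** The norm on matrices is the maximum norm, and the square of each coordinate is a summand of
    [sqn x]. *)
Lemma sqr_norm_le_sqn {n} (x : 'cV[R]_n) : `|x| ^+ 2 <= sqn x.
Proof.
rewrite -(@ler_sqrt _ (`|x| ^+ 2)) ?sqn_ge0// sqrtr_sqr normr_id.
apply: norm_mx_le => [|i j]; first exact: sqrtr_ge0.
rewrite ord1 -sqrtr_sqr ler_sqrt ?sqn_ge0// sqnE (bigD1 i)//= lerDl.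
by rewrite sumr_ge0// => k _; rewrite sqr_ge0.
Qed.

Lemma cvg_sqn {n} {X : Type} {F : set_system X} {FF : Filter F}
    (x : X -> 'cV[R]_n) (a : 'cV[R]_n) :
  x @ F --> a -> sqn (x t) @[t --> F] --> sqn a.
Proof. by move=> xa; apply/cvg_entry/cvg_mulmx => //; exact: cvg_trmx. Qed.

Lemma is_derive_sqn {V : normedModType R} {n} (f : V -> 'cV[R]_n) (x v : V) df :
  is_derive x v f df ->
  is_derive x v (fun y => sqn (f y)) (2 * ((f x)^T *m df) 0 0).
Proof.
move=> hf; have /is_derive_mxP/(_ 0 0) := is_derive_mulmx (is_derive_trmx hf) hf.
move=> /is_derive_eq; apply.
by rewrite mxE [(df^T *m _) 0 0]dotmxC mulr_natl mulr2n.
Qed.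

End euclidean_square.

(** * Bounded signals and convergence at infinity *)

Section signals.
Context {R : realType}.

Lemma bounded_inP {X : Type} {W : normedModType R} (f : X -> W) (A : set X) :
  [bounded f x | x in A] <-> exists K, forall x, A x -> `|f x| <= K.
Proof.
split=> [[K [_ h]]|[K h]].
  by exists (K + 1) => x Ax; apply: h => //; rewrite ltrDl.
exists K; split; first exact: num_real.
by move=> L KL x Ax; apply: le_trans (h x Ax) _; exact: ltW.
Qed.

Lemma bounded_signalP {W : normedModType R} (x : R -> W) :
  bounded_signal x <-> exists K, forall t, 0 <= t -> `|x t| <= K.
Proof.
rewrite /bounded_signal bounded_inP; split=> -[K h]; exists K => t.
  by move=> t0; apply: h; rewrite /= in_itv/= t0.
by rewrite /= in_itv/= andbT; exact: h.
Qed.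

Lemma bounded_signalD {W : normedModType R} (x y : R -> W) :
  bounded_signal x -> bounded_signal y -> bounded_signal (fun t => x t + y t).
Proof.
move=> /bounded_signalP[K hK] /bounded_signalP[L hL]; apply/bounded_signalP.
exists (K + L) => t t0.
by rewrite (le_trans (ler_normD _ _))// lerD ?hK ?hL.
Qed.

Lemma bounded_signalN {W : normedModType R} (x : R -> W) :
  bounded_signal x -> bounded_signal (fun t => - x t).
Proof.
move=> /bounded_signalP[K hK]; apply/bounded_signalP.
by exists K => t t0; rewrite normrN hK.
Qed.

Lemma bounded_signalB {W : normedModType R} (x y : R -> W) :
  bounded_signal x -> bounded_signal y -> bounded_signal (fun t => x t - y t).
Proof. by move=> hx hy; apply: bounded_signalD => //; exact: bounded_signalN. Qed.

Lemma bounded_signal_cst {W : normedModType R} (a : W) :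
  bounded_signal (fun _ : R => a).
Proof. by apply/bounded_signalP; exists `|a|. Qed.

Lemma bounded_signal_mulmx {m n k} (A : R -> 'M[R]_(m, n))
    (B : R -> 'M[R]_(n, k)) :
  bounded_signal A -> bounded_signal B -> bounded_signal (fun t => A t *m B t).
Proof.
move=> /bounded_signalP[K hK] /bounded_signalP[L hL]; apply/bounded_signalP.
exists (n%:R * (K * L)) => t t0; rewrite (le_trans (norm_mulmx_le _ _))//.
by rewrite ler_wpM2l// ler_pM// ?hK ?hL.
Qed.

Lemma bounded_signalZ {W : normedModType R} (c : R) (x : R -> W) :
  bounded_signal x -> bounded_signal (fun t => c *: x t).
Proof.
move=> /bounded_signalP[K hK]; apply/bounded_signalP.
by exists (`|c| * K) => t t0; rewrite normrZ ler_wpM2l ?hK.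
Qed.

Lemma bounded_signal_trmx {m n} (A : R -> 'M[R]_(m, n)) :
  bounded_signal A -> bounded_signal (fun t => (A t)^T).
Proof.
move=> /bounded_signalP[K hK]; apply/bounded_signalP.
by exists K => t t0; rewrite norm_trmx hK.
Qed.

Lemma bounded_signal_diag_mx {n} (x : R -> 'rV[R]_n) :
  bounded_signal x -> bounded_signal (fun t => diag_mx (x t)).
Proof.
move=> /bounded_signalP[K hK]; apply/bounded_signalP.
exists K => t t0; apply: norm_mx_le => [|i j].
  exact: le_trans (hK _ t0).
rewrite mxE; have h := le_trans (norm_entry_le (x t) 0 i) (hK _ t0).
by case: (i == j); rewrite ?mulr1n ?mulr0n// normr0 (le_trans _ h).
Qed.

Lemma bounded_signal_sqn {n} (x : R -> 'cV[R]_n) (K : R) :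
  (forall t, 0 <= t -> sqn (x t) <= K) -> bounded_signal x.
Proof.
move=> h; apply/bounded_signalP; exists (Num.sqrt K) => t t0.
rewrite -[leLHS]normr_id -sqrtr_sqr ler_wsqrtr//.
exact: le_trans (sqr_norm_le_sqn _) (h _ t0).
Qed.

(** The signal stays in a closed ball, which is compact, so its continuous image is bounded. The
    ball is taken among row vectors to apply [bounded_closed_compact], hence the transpositions. *)
Lemma bounded_signal_comp {n} {W : normedModType R} (f : 'cV[R]_n -> W)
    (x : R -> 'cV[R]_n) :
  continuous f -> bounded_signal x -> bounded_signal (fun t => f (x t)).
Proof.
move=> cf /bounded_signalP[K hK]; pose A := [set v : 'rV[R]_n | `|v| <= K].
have cptA : compact A.
  apply: bounded_closed_compact.
    by rewrite /=; apply/bounded_inP; exists K => v.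
  rewrite (_ : A = (fun v : 'rV[R]_n => `|v|) @^-1` [set y : R | y <= K])//.
  by apply: closed_comp => [v _|]; [exact: norm_continuous|exact: closed_le].
have cg : {within A, continuous (fun v => f v^T)}.
  apply: continuous_subspaceT => v; apply: continuous_comp; last exact: cf.
  by apply: (@cvg_trmx _ _ _ _ (nbhs v) _ id); exact: cvg_id.
have /compact_bounded := continuous_compact cg cptA.
move=> /bounded_inP[L hL]; apply/bounded_signalP; exists L => t t0.
by apply: hL; exists (x t)^T; rewrite ?trmxK// /A/= norm_trmx hK.
Qed.

(** With [0 < a] the closed interval lies where the derivative is given, so nothing is asked of [f]
    at [0]. *)
Lemma MVT_pos (f df : R -> R) (a b : R) :
  (forall t : R, 0 < t -> is_derive t 1 f (df t)) -> 0 < a -> a < b ->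
  exists2 c, a < c < b & f b - f a = df c * (b - a).
Proof.
move=> hf a0 ab; have [||c + ->] := @MVT _ f df a b ab.
- by move=> t; rewrite in_itv/= => /andP[at_ _]; exact/hf/(lt_trans a0).
- apply: derivable_within_continuous => t; rewrite in_itv/= => /andP[at_ _].
  by case: (hf t (lt_le_trans a0 at_)).
by rewrite in_itv/=; exists c.
Qed.

Lemma sqn_cvg0 {n} (x : R -> 'cV[R]_n) :
  sqn (x t) @[t --> +oo] --> 0 -> x t @[t --> +oo] --> (0 : 'cV[R]_n).
Proof.
move=> /cvgrPdist_le h; apply/cvgrPdist_le => /= e e0.
have := h (e ^+ 2); rewrite exprn_gt0// => /(_ isT).
apply: filterS => t; rewrite !sub0r !normrN ger0_norm ?sqn_ge0// => le.
rewrite -(@ler_pXn2r _ 2) ?nnegrE//; last exact: ltW.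
exact: le_trans (sqr_norm_le_sqn _) _.
Qed.

Lemma mulmx_cvg0 {m n k} (A : R -> 'M[R]_(m, n)) (x : R -> 'M[R]_(n, k)) :
  bounded_signal A -> x t @[t --> +oo] --> (0 : 'M[R]_(n, k)) ->
  A t *m x t @[t --> +oo] --> (0 : 'M[R]_(m, k)).
Proof.
move=> /bounded_signalP[K hK] /cvgrPdist_le x0; apply/cvgrPdist_le => /= e e0.
have K0 : 0 <= K by apply: le_trans (hK 0 (lexx 0)).
(* The added [1] keeps the divisor positive when [n] or [K] is zero. *)
have c0 : 0 < n%:R * K + 1 by rewrite ltr_wpDl// mulr_ge0.
near=> t.
have t0 : 0 <= t by near: t; apply: nbhs_pinfty_ge; exact: num_real.
have : `|0 - x t| <= e / (n%:R * K + 1).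
  by near: t; apply: x0; rewrite divr_gt0.
rewrite !sub0r !normrN ler_pdivlMr// => xe.
apply: le_trans (norm_mulmx_le _ _) _; apply: le_trans xe.
apply: (@le_trans _ _ (n%:R * K * `|x t|)).
  by rewrite mulrA ler_wpM2r// ler_wpM2l// hK.
by rewrite mulrDr mulr1 [`|x t| * _]mulrC lerDl.
Unshelve. all: by end_near. Qed.

(* Barbalat's argument without integrals: if [f t > e], the bound on [df] keeps
   [f >= e / 2] on an interval of fixed length [dl], over which [W] loses a fixed
   amount; this is impossible once [W] is close to its infimum. *)
Lemma dissipation_cvg0 (W dW f df : R -> R) (c K : R) :
  0 < c ->
  (forall t : R, 0 < t -> is_derive t 1 W (dW t)) ->
  (forall t, 0 < t -> dW t <= - (c * f t)) ->
  (forall t, 0 < t -> 0 <= W t) ->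
  (forall t : R, 0 < t -> is_derive t 1 f (df t)) ->
  (forall t, 0 < t -> `|df t| <= K) ->
  (forall t, 0 < t -> 0 <= f t) ->
  f t @[t --> +oo] --> 0.
Proof.
(* The bound is enlarged to [|K| + 1] so that one can divide by it in [dl]. *)
move=> c0 hW hdW W0 hf hdf f0; wlog K0 : K hdf / 0 < K.
  move=> /(_ (`|K| + 1)); apply; last by rewrite ltr_wpDl.
  by move=> t t0; rewrite (le_trans (hdf t t0))// ler_wpDr// ler_norm.
have Wle a b : 0 < a -> a <= b -> W b <= W a.
  rewrite le_eqVlt => a0 /predU1P[->//|ab].
  have [s /andP[as_ _] Es] := MVT_pos hW a0 ab.
  have s0 := lt_trans a0 as_.
  rewrite -subr_le0 Es mulr_le0_ge0 ?subr_ge0 ?(ltW ab)//.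
  by rewrite (le_trans (hdW s s0))// oppr_le0 mulr_ge0 ?f0// ltW.
pose S := W @` [set t | 0 < t].
have Sinf : has_inf S.
  by split; [exists (W 1), 1 => /=|exists 0 => _ [t t0 <-]; exact: W0].
(* Within time [dl] the function [f] changes by at most [K * dl = e / 2]. *)
apply/cvgrPdist_le => /= e e0; pose dl := e / (2 * K).
have dl0 : 0 < dl by rewrite divr_gt0// mulr_gt0.
have eta0 : 0 < c * (e / 2) * dl.
  by apply: mulr_gt0 => //; rewrite mulr_gt0// divr_gt0.
(* [W t1] exceeds the infimum by less than the loss that [f >= e / 2] would cause over a time [dl];
   by monotonicity this persists after [t1]. *)
have [_ [t1 /= t10 <-] Wt1] := inf_adherent eta0 Sinf.
near=> t.
have t1t : t1 <= t by near: t; apply: nbhs_pinfty_ge; exact: num_real.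
have t0 : 0 < t by exact: lt_le_trans t1t.
rewrite sub0r normrN ger0_norm ?f0// leNgt; apply/negP => fte.
have tdl : t < t + dl by rewrite ltrDl.
have [s /andP[ts sdl] Es] := MVT_pos hW t0 tdl.
have s0 := lt_trans t0 ts.
have fs : e / 2 <= f s.
  have [z /andP[tz zs] Ez] := MVT_pos hf t0 ts.
  have hz : `|df z * (s - t)| <= e / 2.
    have -> : e / 2 = K * dl by rewrite /dl; field; rewrite gt_eqF.
    rewrite normrM ler_pM//; first exact/hdf/(lt_trans t0).
    by rewrite ger0_norm ?subr_ge0 ?(ltW ts)// lerBlDr addrC ltW.
  by move: hz; rewrite -Ez ler_norml => /andP[+ _]; move: fte; lra.
have Wlb : inf S <= W (t + dl).
  by apply: ge_inf; [case: Sinf|exists (t + dl) => //=; exact: lt_trans tdl].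
(* Such a decrease from [W t <= W t1] would put [W (t + dl)] strictly below [inf S]. *)
suff : dW s * (t + dl - t) <= - (c * (e / 2) * dl).
  by rewrite -Es; have := Wle _ _ t10 t1t; move: Wlb Wt1; lra.
rewrite addrAC subrr add0r -mulNr ler_pM2r// (le_trans (hdW s s0))//.
by rewrite lerN2 ler_pM2l.
Unshelve. all: by end_near. Qed.

End signals.

(** * Factorization of the regressor and splitting of the friction matrix *)

Section unknown_friction.
Context {R : realType} {n s : nat}.
Implicit Types (kappa : 'I_s -> 'I_n) (A : 'M[R]_n) (v : 'cV[R]_n).

Lemma mul_trmx_ebasis {k} (i : 'I_n) (A : 'M[R]_(n, k)) :
  (ebasis i)^T *m A = row i A.
Proof. by rewrite trmx_delta -rowE. Qed.

Lemma mul_trC_mx {k} kappa (A : 'M[R]_(n, k)) :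
  (C_mx kappa)^T *m A = rowsub kappa A.
Proof.
apply/matrixP => j l.
rewrite mxE (bigD1 (kappa j))//= !mxE !eqxx mul1r big1 ?addr0// => i /negbTE ne.
by rewrite !mxE ne mul0r.
Qed.

Lemma Y_mxE kappa A (j : 'I_n) (a : 'I_n) (b : 'I_s) :
  Y_mx kappa A j a b = A (kappa b) a * A (kappa b) j.
Proof.
(* Each summand is the scalar [A i j] times the outer product of row [i] of [A] and row [i] of
   [C_mx]; column [b] of [C_mx] then selects the single index [i = kappa b]. *)
have termE i : A^T *m ebasis i *m (ebasis i)^T *m A *m ebasis j
    *m (ebasis i)^T *m C_mx kappa = A i j *: ((row i A)^T *m row i (C_mx kappa)).
  transitivity ((A^T *m ebasis i) *m ((ebasis i)^T *m A *m ebasis j)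
      *m ((ebasis i)^T *m C_mx kappa)); first by rewrite !mulmxA.
  have -> : A^T *m ebasis i = (row i A)^T.
    by rewrite -mul_trmx_ebasis trmx_mul trmxK.
  rewrite !mul_trmx_ebasis; have -> : row i A *m ebasis j = (A i j)%:M.
    by rewrite -colE; apply/matrixP => x y; rewrite !ord1 !mxE eqxx.
  by rewrite mul_mx_scalar -scalemxAl.
rewrite /Y_mx; under eq_bigr do rewrite termE.
rewrite summxE (bigD1 (kappa b))//= !mxE big_ord1 !mxE !eqxx mulr1 mulrC.
rewrite big1 ?addr0// => i /negbTE ne.
by rewrite !mxE big_ord1 !mxE ne !mulr0.
Qed.

(** By [Y_mxE] the regressor sees [A] only through the rows indexed by [kappa]; for [A = T(q)] these
    are constant, so it depends on the state through [v] alone. *)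
Lemma sum_Y_mx kappa A v :
  \sum_i v i 0 *: Y_mx kappa A i =
  (rowsub kappa A)^T *m diag_mx (rowsub kappa A *m v)^T.
Proof.
apply/matrixP => a b; rewrite summxE mul_mx_diag !mxE.
rewrite mulr_sumr; apply: eq_bigr => j _.
by rewrite !mxE Y_mxE; ring.
Qed.

Lemma sum_trmx_Y_mx kappa A v :
  \sum_i v i 0 *: (Y_mx kappa A i)^T =
  diag_mx (rowsub kappa A *m v)^T *m rowsub kappa A.
Proof.
apply: trmx_inj; rewrite trmx_mul tr_diag_mx -sum_Y_mx linear_sum.
by apply: eq_bigr => i _; rewrite linearZ/= trmxK.
Qed.

(** [L_mx A (kappa j)] is the outer square of row [kappa j] of [A], so its quadratic form is a
    perfect square. *)
Lemma L_mx_quad kappa A v j :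
  (v^T *m L_mx A (kappa j) *m v) 0 0 = ((rowsub kappa A *m v) j 0) ^+ 2.
Proof.
have -> : v^T *m L_mx A (kappa j) *m v =
    ((ebasis (kappa j))^T *m (A *m v))^T *m ((ebasis (kappa j))^T *m (A *m v)).
  by rewrite /L_mx !trmx_mul trmxK !mulmxA.
rewrite mul_trmx_ebasis mxE big_ord1 !mxE -expr2.
by congr (_ ^+ 2); apply: eq_bigr => i _; rewrite mxE.
Qed.

(** Injectivity of [kappa] makes each unknown coefficient appear exactly once in the second
    summand. *)
Lemma diag_friction_split kappa (r : 'cV[R]_n) : injective kappa ->
  diag_mx r^T = Rfrak_k kappa r +
    C_mx kappa *m diag_mx (r_unknown kappa r)^T *m (C_mx kappa)^T.
Proof.
move=> inj; apply/matrixP => a b; rewrite /r_unknown mul_trC_mx mul_mx_diag !mxE.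
under eq_bigr do rewrite !mxE.
case: (boolP (a \in codom kappa)) => [/codomP[j ->]|ak].
  rewrite mul0rn add0r (bigD1 j)//= eqxx mul1r big1 ?addr0 => [|i ij].
    by rewrite andbT eq_sym mulr_natr.
  by rewrite (inj_eq inj) eq_sym (negbTE ij) !mul0r.
rewrite big1 ?addr0// => i _; have /negbTE -> : a != kappa i.
  by apply: contraNneq ak => ->; exact: codom_f.
by rewrite !mul0r.
Qed.

End unknown_friction.

(** * Symmetry of the derivative of a matrix with commuting columns *)

Section commuting_columns.
Context {R : realType} {n : nat}.

Lemma mulmx_sum_col {m k} (A : 'M[R]_(m, k)) (v : 'cV[R]_k) :
  A *m v = \sum_j v j 0 *: col j A.
Proof.
apply/colP => i; rewrite mxE summxE; apply: eq_bigr => j _.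
by rewrite !mxE mulrC.
Qed.

Lemma derive_sum_dir {V W : normedModType R} {k} (f : V -> W) (x : V)
    (c : 'I_k -> R) (v : 'I_k -> V) : differentiable f x ->
  'D_(\sum_i c i *: v i) f x = \sum_i c i *: 'D_(v i) f x.
Proof.
move=> df; rewrite deriveE// linear_sum; apply: eq_bigr => i _.
by rewrite linearZ deriveE.
Qed.

Lemma Jacobian_col (T : 'cV[R]_n -> 'M[R]_n) x v j : differentiable T x ->
  Jacobian (fun y => col j (T y)) x *m v = col j ('D_v T x).
Proof.
move=> dT; rewrite derive_ebasis//; apply/colP => i.
rewrite mxE [in RHS]mxE summxE; apply: eq_bigr => k _.
rewrite !mxE mulrC; congr (_ * _).
have dTk := differentiable_is_derive (ebasis k) dT.
have /(@derive_val _ _ _ _ _ _ _) := is_derive_mulmx dTk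
  (is_derive_cst (delta_mx j 0 : 'cV[R]_n) x (ebasis k)).
rewrite mulmx0 addr0 => h.
have -> : (fun y => col j (T y)) = (fun y => T y *m delta_mx j 0).
  by apply/funext => y; rewrite colE.
by rewrite h -colE mxE.
Qed.

(** Both sides are bilinear in [v] and [w]. On basis vectors the symmetry is exactly the vanishing
    of the bracket of two columns, and expanding in the basis gives the general case. *)
Lemma commuting_columns_derive (T : 'cV[R]_n -> 'M[R]_n) x :
  differentiable T x ->
  (forall i j,
     Lie_bracket (fun y => col i (T y)) (fun y => col j (T y)) x = 0) ->
  forall v w, 'D_(T x *m v) T x *m w = 'D_(T x *m w) T x *m v.
Proof.
move=> dT comm.
have colC i j : col j ('D_(col i (T x)) T x) = col i ('D_(col j (T x)) T x).
  apply/eqP; rewrite -subr_eq0; apply/eqP.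
  by rewrite -!Jacobian_col//; exact: comm.
have expand v w : 'D_(T x *m v) T x *m w =
    \sum_i \sum_j (v i 0 * w j 0) *: col j ('D_(col i (T x)) T x).
  rewrite [T x *m v]mulmx_sum_col derive_sum_dir// mulmx_suml.
  apply: eq_bigr => i _; rewrite -scalemxAl mulmx_sum_col scaler_sumr.
  by apply: eq_bigr => j _; rewrite scalerA.
move=> v w; rewrite !expand exchange_big; apply: eq_bigr => i _ /=.
by apply: eq_bigr => j _; rewrite colC mulrC.
Qed.

End commuting_columns.

(** * Gradients of the Hamiltonian and dynamics of the transformed momentum *)

Section mechanics.
Context {R : realType} {n m : nat}.
Context (M : 'cV[R]_n -> 'M[R]_n) (V : 'cV[R]_n -> R)
  (G : 'cV[R]_n -> 'M[R]_(n, m)) (T : 'cV[R]_n -> 'M[R]_n).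
Hypothesis V_diff : forall x, differentiable V x.
Hypothesis T_diff : forall x, differentiable T x.
Hypothesis M_factor : forall x, invmx (M x) = T x *m (T x)^T.
Hypothesis T_commute : forall (i j : 'I_n) x,
  Lie_bracket (fun y => col i (T y)) (fun y => col j (T y)) x = 0.

Lemma HamiltonianE q p :
  Hamiltonian M V q p = 2^-1 * sqn ((T q)^T *m p) + V q.
Proof. by rewrite /Hamiltonian M_factor /sqn trmx_mul trmxK !mulmxA. Qed.

Lemma gradH_pE q p : gradH_p M V q p = T q *m ((T q)^T *m p).
Proof.
apply/colP => k; rewrite mxE; under eq_fun do rewrite HamiltonianE.
have h : is_derive p (ebasis k) (fun x => (T q)^T *m x) ((T q)^T *m ebasis k).
  apply: is_derive_eq (is_derive_mulmx (is_derive_cst (T q)^T p (ebasis k))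
    (is_derive_id p (ebasis k))) _.
  by rewrite mul0mx add0r.
have h1 := is_deriveD_fun (is_deriveZ_fun 2^-1 (is_derive_sqn h))
  (is_derive_cst (V q) p (ebasis k)).
have -> := @derive_val _ _ _ _ _ _ _ h1.
rewrite addr0 /GRing.scale/= mulrA mulVf ?pnatr_eq0// mul1r dotmxC trmx_mul trmxK.
by rewrite -mulmxA mul_trmx_ebasis mxE.
Qed.

(** Differentiating the half square of [T^T p] at fixed [p] cancels the factor one half. Pairing
    with [v] puts the direction inside the derivative of [T], where commutation can act. *)
Lemma gradH_q_dir q p v :
  (v^T *m gradH_q M V q p) 0 0 =
  (p^T *m ('D_v T q *m ((T q)^T *m p))) 0 0 + 'D_v V q.
Proof.
have gradE k : gradH_q M V q p k 0 =
    (p^T *m ('D_(ebasis k) T q *m ((T q)^T *m p))) 0 0 + 'D_(ebasis k) V q.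
  have dT := differentiable_is_derive (ebasis k) (T_diff q).
  have dV := differentiable_is_derive (ebasis k) (V_diff q).
  have h : is_derive q (ebasis k) (fun x => (T x)^T *m p)
      (('D_(ebasis k) T q)^T *m p).
    apply: is_derive_eq (is_derive_mulmx (is_derive_trmx dT)
      (is_derive_cst p q (ebasis k))) _.
    by rewrite mulmx0 addr0.
  rewrite mxE; under eq_fun do rewrite HamiltonianE.
  have h1 := is_deriveD_fun (is_deriveZ_fun 2^-1 (is_derive_sqn h)) dV.
  have -> := @derive_val _ _ _ _ _ _ _ h1.
  rewrite /GRing.scale/= mulrA mulVf ?pnatr_eq0// mul1r dotmxC trmx_mul trmxK.
  by rewrite -mulmxA.
rewrite mxE; under eq_bigr do rewrite mxE gradE mulrDr.
rewrite big_split/=; congr (_ + _); last by rewrite derive_ebasis.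
rewrite derive_ebasis// mulmx_suml mulmx_sumr summxE; apply: eq_bigr => k _.
by rewrite -scalemxAl -scalemxAr [in RHS]mxE.
Qed.

Lemma is_derive_momentum (r d : 'cV[R]_n) (u : R -> 'cV[R]_m)
    (q p : R -> 'cV[R]_n) (t : R) :
  is_derive t 1 q (gradH_p M V (q t) (p t)) ->
  is_derive t 1 p (- gradH_q M V (q t) (p t)
                   - diag_mx r^T *m gradH_p M V (q t) (p t)
                   + G (q t) *m u t + d) ->
  is_derive t 1 (fun t => (T (q t))^T *m p t)
    (- ((T (q t))^T *m (gradient V (q t) - G (q t) *m u t - d))
     - (T (q t))^T *m diag_mx r^T *m T (q t) *m ((T (q t))^T *m p t)).
Proof.
rewrite gradH_pE => dq dp.
have dTq := is_derive_chain (T_diff (q t)) dq.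
apply: is_derive_eq (is_derive_mulmx (is_derive_trmx dTq) dp) _.
set P := (T (q t))^T *m p t; set D := 'D_(_) T (q t).
(* All that must cancel is the part of the force coming from the [q]-dependence of the kinetic
   energy, against the derivative of [T^T] along the motion. *)
suff key : (T (q t))^T *m gradH_q M V (q t) (p t) =
    D^T *m p t + (T (q t))^T *m gradient V (q t).
  rewrite !(mulmxDr, mulmxN) key !mulmxA !opprD !opprK -!addrA.
  by rewrite addNKr; congr (_ + _); rewrite addrC -addrA.
apply/colP => i; rewrite [in RHS]mxE.
(* Entry [i] of [A^T w] is the pairing of [w] with [A e_i]. This turns the gradients into
   derivatives along the [i]-th column of [T]; commutation then exchanges [e_i] with [P]. *)
have rowE2 (A : 'M[R]_n) (w : 'cV[R]_n) :
    (A^T *m w) i 0 = ((A *m ebasis i)^T *m w) 0 0.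
  by rewrite trmx_mul -mulmxA mul_trmx_ebasis [RHS]mxE.
rewrite !rowE2 gradH_q_dir trmx_mul_gradient//; congr (_ + _).
rewrite dotmxC /D.
by rewrite (commuting_columns_derive (T_diff _) (fun i j => T_commute i j _)).
Qed.

End mechanics.

(** * Diagonal matrices built from vectors *)

Section diagonal.
Context {R : realType}.

(** Both sides are the entrywise product. The exchange rewrites friction as a regressor applied to
    the vector of coefficients. *)
Lemma mul_diag_mxC {n} (z w : 'cV[R]_n) :
  diag_mx z^T *m w = diag_mx w^T *m z.
Proof. by rewrite !mul_diag_mx; apply/colP => i; rewrite !mxE mulrC. Qed.

Lemma diag_form_ge0 {n} (r z : 'cV[R]_n) : (forall i, 0 <= r i 0) ->
  0 <= (z^T *m diag_mx r^T *m z) 0 0.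
Proof.
move=> r0; rewrite mul_mx_diag mxE sumr_ge0// => i _.
by rewrite !mxE mulrAC -expr2 mulr_ge0 ?sqr_ge0.
Qed.

Lemma cvg_diag_mx {n} {X : Type} {F : set_system X} {FF : Filter F}
    (x : X -> 'rV[R]_n) (a : 'rV[R]_n) :
  x @ F --> a -> diag_mx (x t) @[t --> F] --> diag_mx a.
Proof.
move=> xa; apply: cvg_mx => i j; rewrite mxE; under eq_fun do rewrite mxE.
by case: (i == j); [exact: cvg_entry|exact: cvg_cst].
Qed.

Lemma is_derive_diag_mx {V : normedModType R} {n} (f : V -> 'rV[R]_n)
    (x v : V) df :
  is_derive x v f df -> is_derive x v (fun y => diag_mx (f y)) (diag_mx df).
Proof.
move=> /is_derive_mxP hf; apply/is_derive_mxP => i j; rewrite mxE.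
under eq_fun do rewrite mxE.
by case: (i == j); [exact: hf|exact: is_derive_cst].
Qed.

End diagonal.

(** * Algebra of the error equations *)

Section observer_algebra.
Context {R : realType} {n m s : nat}.
Context (kappa : 'I_s -> 'I_n) (V : 'cV[R]_n -> R)
  (G : 'cV[R]_n -> 'M[R]_(n, m)) (T : 'cV[R]_n -> 'M[R]_n)
  (Q : 'cV[R]_n -> 'cV[R]_n) (lambda : R) (r : 'cV[R]_n).

Lemma ru_hatE q pI rI :
  let z := rowsub kappa (T q) *m p_hat Q lambda q pI in
  ru_hat kappa T Q lambda q pI rI = rI - (2 * lambda)^-1 *: (diag_mx z^T *m z).
Proof.
move=> z; congr (_ - _ *: _).
under eq_bigr do rewrite L_mx_quad.
rewrite -/z; move: z => z; apply/colP => j; rewrite summxE mul_diag_mx.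
rewrite (bigD1 j)//= !mxE !eqxx mulr1 big1 ?addr0 ?expr2// => i ij.
by rewrite !mxE eq_sym (negbTE ij) mulr0.
Qed.

(** On trajectories the left side is the derivative of [p_hat - P]. The observer copies the equation
    of [P] with estimates in place of [d] and the unknown coefficients, and adds damping [lambda];
    what remains is linear in the errors. *)
Lemma pI_rhs_error u q pI rI dI d P : injective kappa ->
  let A := T q in let B := rowsub kappa A in let v := p_hat Q lambda q pI in
  pI_rhs kappa V G T Q lambda r u q pI rI dI + lambda *: P
  - (- (A^T *m (gradient V q - G q *m u - d)) - A^T *m diag_mx r^T *m A *m P) =
  A^T *m (d_hat q dI - d) - lambda *: (v - P)
  - A^T *m diag_mx r^T *m A *m (v - P)
  - B^T *m diag_mx (B *m v)^T
    *m (ru_hat kappa T Q lambda q pI rI - r_unknown kappa r).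
Proof.
move=> inj A B v; rewrite /pI_rhs sum_Y_mx -/A -/v -/B.
move: (ru_hat _ _ _ _ _ _ _) (d_hat _ _) => hr hd; clearbody v.
(* Total friction at [v] is its known part plus the regressor applied to the true coefficients, so
   comparison with the observer leaves only the error of [hr]. *)
have frictionE : A^T *m diag_mx r^T *m A *m v =
    R_k kappa r A *m v + B^T *m diag_mx (B *m v)^T *m r_unknown kappa r.
  rewrite (diag_friction_split r inj) mulmxDr !mulmxDl; congr (_ + _).
  rewrite -(mulmxA B^T) mul_diag_mxC /B -!mul_trC_mx !trmx_mul !trmxK.
  by rewrite !mulmxA.
rewrite !(mulmxBr, mulmxDl) frictionE mul_scalar_mx.
move: (A^T *m gradient V q) (A^T *m (G q *m u)) (A^T *m hd) => a b c.
move: (A^T *m d) (_ *m hr) (_ *m r_unknown _ _) => e f g.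
move: (R_k kappa r A *m v) (_ *m P) => h k.
by apply/colP => i; rewrite !mxE; ring.
Qed.

(** The subtracted term is the derivative of the quadratic correction in [ru_hat]; it involves the
    unmeasured [P] through [dv]. The update law has the same term with [p_hat] for [P], and the
    mismatch [lambda *: (v - P)] drives the error. *)
Lemma rI_rhs_error u q pI rI dI P : lambda != 0 ->
  let B := rowsub kappa (T q) in let v := p_hat Q lambda q pI in
  let dv := pI_rhs kappa V G T Q lambda r u q pI rI dI + lambda *: P in
  rI_rhs kappa V G T Q lambda r u q pI rI dI
  - lambda^-1 *: (diag_mx (B *m v)^T *m (B *m dv)) =
  diag_mx (B *m v)^T *m B *m (v - P).
Proof.
move=> l0 B v dv; rewrite /rI_rhs sum_trmx_Y_mx -/B -/v mulmxA -scalerBr -mulmxBr.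
have -> : pI_rhs kappa V G T Q lambda r u q pI rI dI + lambda *: v - dv =
    lambda *: (v - P).
  rewrite /dv; move: (pI_rhs _ _ _ _ _ _ _ _ _ _ _ _) => w; clearbody v.
  by apply/colP => i; rewrite !mxE; ring.
by rewrite -scalemxAr scalerA mulVf// scale1r.
Qed.

(** The couplings through [A] and through [Y] are skew-symmetric and cancel, which leaves the
    injected damping and the friction. *)
Lemma lyapunov_identity (A : 'M[R]_n) (Y : 'M[R]_(n, s)) (x : 'cV[R]_n)
    (y : 'cV[R]_s) (z : 'cV[R]_n) :
  (x^T *m (A^T *m z - lambda *: x - A^T *m diag_mx r^T *m A *m x - Y *m y)) 0 0
  + (y^T *m (Y^T *m x)) 0 0 + (z^T *m - (A *m x)) 0 0 =
  - (lambda * sqn x) - ((A *m x)^T *m diag_mx r^T *m (A *m x)) 0 0.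
Proof.
have -> : (y^T *m (Y^T *m x)) 0 0 = (x^T *m (Y *m y)) 0 0.
  by rewrite [RHS]dotmxC trmx_mul mulmxA.
have -> : (z^T *m - (A *m x)) 0 0 = - (x^T *m (A^T *m z)) 0 0.
  by rewrite mulmxN [LHS]mxE (dotmxC z) trmx_mul mulmxA.
have -> : (A *m x)^T *m diag_mx r^T *m (A *m x) =
    x^T *m (A^T *m diag_mx r^T *m A *m x) by rewrite trmx_mul !mulmxA.
rewrite !mulmxBr -scalemxAr /sqn.
by rewrite !(mxE, mulmxBr); ring.
Qed.

End observer_algebra.

(** * Lyapunov analysis of the error system *)

Section adaptive_error_system.
Context {R : realType} {n s : nat}.
Context (lambda : R) (r : 'cV[R]_n) (A : R -> 'M[R]_n) (Y : R -> 'M[R]_(n, s))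
  (x : R -> 'cV[R]_n) (y : R -> 'cV[R]_s) (z : R -> 'cV[R]_n).
Hypothesis lambda_gt0 : 0 < lambda.
Hypothesis r_ge0 : forall i, 0 <= r i 0.
Hypothesis x_solves : solves x (fun t =>
  (A t)^T *m z t - lambda *: x t - (A t)^T *m diag_mx r^T *m A t *m x t
  - Y t *m y t).
Hypothesis y_solves : solves y (fun t => (Y t)^T *m x t).
Hypothesis z_solves : solves z (fun t => - (A t *m x t)).

Definition error_energy t : R := sqn (x t) + sqn (y t) + sqn (z t).

Lemma is_derive_error_energy (t : R) : 0 < t ->
  is_derive t 1 error_energy
    (- (2 * lambda * sqn (x t))
     - 2 * ((A t *m x t)^T *m diag_mx r^T *m (A t *m x t)) 0 0).
Proof.
move=> t0; have [_ dx] := x_solves; have [_ dy] := y_solves.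
have [_ dz] := z_solves.
apply: is_derive_eq (is_deriveD_fun (is_deriveD_fun (is_derive_sqn (dx t t0))
  (is_derive_sqn (dy t t0))) (is_derive_sqn (dz t t0))) _.
by rewrite -!mulrDr lyapunov_identity; ring.
Qed.

Lemma error_energy_derive_le (t : R) :
  - (2 * lambda * sqn (x t))
  - 2 * ((A t *m x t)^T *m diag_mx r^T *m (A t *m x t)) 0 0
  <= - (2 * lambda * sqn (x t)).
Proof. by rewrite gerDl oppr_le0 mulr_ge0// diag_form_ge0. Qed.

Lemma error_energy_ge0 t : 0 <= error_energy t.
Proof. by rewrite !addr_ge0 ?sqn_ge0. Qed.

(** The derivative is nonpositive at positive times; continuity up to [0] lets the initial value
    serve as the bound. *)
Lemma error_energy_le0 (t : R) : 0 <= t -> error_energy t <= error_energy 0.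
Proof.
move=> t0; apply: (@ler0_derive1_nincry _ error_energy 0) => //.
- move=> u; rewrite in_itv/= andbT => u0.
  by case: (is_derive_error_energy u0).
- move=> u; rewrite in_itv/= andbT => u0.
  rewrite derive1E (@derive_val _ _ _ _ _ _ _ (is_derive_error_energy u0)).
  rewrite (le_trans (error_energy_derive_le u))// oppr_le0.
  by rewrite !mulr_ge0 ?sqn_ge0// ltW.
- have [cx _] := x_solves; have [cy _] := y_solves; have [cz _] := z_solves.
  by move=> u; apply: cvgD; [apply: cvgD|]; apply: cvg_sqn;
    [exact: cx|exact: cy|exact: cz].
Qed.

Lemma errors_bounded :
  [/\ bounded_signal x, bounded_signal y & bounded_signal z].
Proof.
by split; apply: (@bounded_signal_sqn _ _ _ (error_energy 0)) => t t0;
  rewrite (le_trans _ (error_energy_le0 t0))// /error_energy;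
  have := sqn_ge0 (x t); have := sqn_ge0 (y t); have := sqn_ge0 (z t); lra.
Qed.

Lemma error_cvg0 : bounded_signal A -> bounded_signal Y ->
  x t @[t --> +oo] --> (0 : 'cV[R]_n).
Proof.
move=> bA bY; have [bx by_ bz] := errors_bounded.
have [_ dx] := x_solves.
(* [f] is half the derivative of [sqn (x t)], kept as a matrix so that the boundedness rules for
   products apply. Bounding it is where [bA] and [bY] enter. *)
pose f (t : R) : 'M[R]_1 := (x t)^T *m ((A t)^T *m z t - lambda *: x t
  - (A t)^T *m diag_mx r^T *m A t *m x t - Y t *m y t).
have /bounded_signalP[K hK] : bounded_signal f.
  have bAT := bounded_signal_trmx bA.
  apply: bounded_signal_mulmx; first exact: bounded_signal_trmx.
  apply: bounded_signalB; last exact: bounded_signal_mulmx.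
  apply: bounded_signalB.
    by apply: bounded_signalB; [exact: bounded_signal_mulmx|exact: bounded_signalZ].
  do 2?[apply: bounded_signal_mulmx => //].
  by apply: bounded_signal_mulmx => //; exact: bounded_signal_cst.
apply: sqn_cvg0.
apply: (@dissipation_cvg0 _ error_energy _ _ (fun t => 2 * f t 0 0)
  (2 * lambda) (2 * K) _ is_derive_error_energy) => [|t _|t _|t t0|t t0|t _].
- by rewrite mulr_gt0.
- exact: error_energy_derive_le.
- exact: error_energy_ge0.
- exact: is_derive_sqn (dx t t0).
- rewrite normrM ger0_norm// ler_pM2l//.
  exact: le_trans (norm_entry_le _ _ _) (hK _ (ltW t0)).
- exact: sqn_ge0.
Qed.

End adaptive_error_system.

(** * Boundedness of the observer and convergence of the momentum estimate *)

Lemma smooth_differentiable {R : realType} {V W : normedModType R} (f : V -> W) :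
  smooth f -> forall x, differentiable f x.
Proof. by move=> /(_ 1%N)[]. Qed.

Theorem proposition1 (R : realType) (n m s : nat)
  (M : 'cV[R]_n -> 'M[R]_n) (V : 'cV[R]_n -> R)
  (G : 'cV[R]_n -> 'M[R]_(n, m)) (T : 'cV[R]_n -> 'M[R]_n)
  (Q : 'cV[R]_n -> 'cV[R]_n)
  (kappa : 'I_s -> 'I_n) (r d : 'cV[R]_n) (lambda : R)
  (M_smooth : smooth M) (V_smooth : smooth V)
  (G_smooth : smooth G) (T_smooth : smooth T)
  (M_posdef : forall x, posdefmx (M x))
  (kappa_incr : forall i j : 'I_s, (i < j)%N -> (kappa i < kappa j)%N)
  (r_ge0 : forall i, 0 <= r i 0)
  (T_full_rank : forall x, \rank (T x) = n)
  (M_factor : forall x, invmx (M x) = T x *m (T x)^T)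
  (T_commute : forall (i j : 'I_n) x,
     Lie_bracket (fun y => col i (T y)) (fun y => col j (T y)) x = 0)
  (T_rows : forall (i : 'I_s) x y, row (kappa i) (T x) = row (kappa i) (T y))
  (Q_diff : forall x, differentiable Q x)
  (Q_jac : forall x, Jacobian Q x = invmx (T x))
  (lambda_gt0 : 0 < lambda)
  (u : R -> 'cV[R]_m) (q p : R -> 'cV[R]_n)
  (sys : system_trajectory M V G r d u q p)
  (pI : R -> 'cV[R]_n) (rI : R -> 'cV[R]_s) (dI : R -> 'cV[R]_n)
  (obs : observer_trajectory kappa V G T Q lambda r u q pI rI dI) :
  let hp := fun t => p_hat Q lambda (q t) (pI t) in
  let hr := fun t => ru_hat kappa T Q lambda (q t) (pI t) (rI t) in
  let hd := fun t => d_hat (q t) (dI t) in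
  let hbp := fun t => bp_hat T Q lambda (q t) (pI t) in
  [/\ (* the estimation errors are bounded for every system trajectory *)
      [/\ bounded_signal (fun t => hp t - (T (q t))^T *m p t),
          bounded_signal (fun t => hr t - r_unknown kappa r)
        & bounded_signal (fun t => hd t - d)],
      (* boundedness of all signals *)
      bounded_signal q -> bounded_signal p ->
      [/\ bounded_signal pI, bounded_signal rI & bounded_signal dI] /\
      [/\ bounded_signal hp, bounded_signal hr, bounded_signal hd
        & bounded_signal hbp]
    & (* convergence; the premises hold in particular if q and p are bounded *)
      bounded_signal (fun t => T (q t)) ->
      bounded_signal (fun t => invmx (T (q t))) ->
      bounded_signal p ->
      hbp t - p t @[t --> +oo] --> (0 : 'cV[R]_n)].
Proof.
move=> hp hr hd hbp.
have T_diff := smooth_differentiable T_smooth.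
have V_diff := smooth_differentiable V_smooth.
have T_cont x : {for x, continuous T} by exact: differentiable_continuous.
have Q_cont x : {for x, continuous Q} by exact: differentiable_continuous.
have kappa_inj : injective kappa.
  move=> i j ij; apply: val_inj.
  by have [/kappa_incr|/kappa_incr|//] := ltngtP i j; rewrite ij ltnn.
have T_unit x : T x \in unitmx.
  by rewrite -row_free_unit /row_free T_full_rank.
have l0 : lambda != 0 by rewrite gt_eqF.
(* The base point [0] is arbitrary, since the selected rows of [T] are constant. *)
pose B : 'M[R]_(s, n) := rowsub kappa (T 0).
have BE x : rowsub kappa (T x) = B.
  by apply/row_matrixP => i; rewrite !row_rowsub; exact: T_rows.
pose P t := (T (q t))^T *m p t.
pose Y t := B^T *m diag_mx (B *m hp t)^T.
have [[cq dq'] [cp dp']] := sys; have [[cpI dpI] [crI drI] [cdI ddI]] := obs.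
have dq (t : R) : 0 < t -> is_derive t 1 q (T (q t) *m P t).
  by move=> t0; rewrite -(gradH_pE V M_factor); exact: dq'.
have dP (t : R) (t0 : 0 < t) := is_derive_momentum V_diff T_diff M_factor T_commute
  (dq' t t0) (dp' t t0).
have dhp (t : R) : 0 < t -> is_derive t 1 hp
    (pI_rhs kappa V G T Q lambda r (u t) (q t) (pI t) (rI t) (dI t)
     + lambda *: P t).
  move=> t0; apply: is_deriveD_fun; first exact: dpI.
  (* Along the motion [Q (q t)] has derivative [T^-1 (T P) = P]. *)
  apply: is_deriveZ_fun; have := is_derive_chain (Q_diff (q t)) (dq t t0).
  by rewrite -Jacobian_mulmx// Q_jac mulKmx.
have hrE : hr = (fun t => rI t
    - (2 * lambda)^-1 *: (diag_mx (B *m hp t)^T *m (B *m hp t))).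
  by apply/funext => t; rewrite /hr ru_hatE BE.
have chp : {within `[0, +oo[, continuous hp}.
  move=> t; apply: cvgD; first exact: cpI.
  by apply: cvgZl_tmp; exact: (cvg_comp _ _ (cq t) (Q_cont (q t))).
have cBhp : {within `[0, +oo[, continuous (fun t => B *m hp t)}.
  by move=> t; apply: cvg_mulmx; [exact: cvg_cst|exact: chp].
have ep_solves : solves (fun t => hp t - P t) (fun t =>
    (T (q t))^T *m (hd t - d) - lambda *: (hp t - P t)
    - (T (q t))^T *m diag_mx r^T *m T (q t) *m (hp t - P t)
    - Y t *m (hr t - r_unknown kappa r)).
  split=> [t|t t0].
    apply: cvgB; first exact: chp.
    apply: cvg_mulmx; last exact: cp.
    by apply: cvg_trmx; exact: (cvg_comp _ _ (cq t) (T_cont (q t))).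
  apply: is_derive_eq (is_deriveB_fun (dhp t t0) (dP t t0)) _.
  by rewrite pI_rhs_error// BE.
have er_solves : solves (fun t => hr t - r_unknown kappa r)
    (fun t => (Y t)^T *m (hp t - P t)).
  split=> [t|t t0].
    apply: cvgB; last exact: cvg_cst.
    rewrite hrE; apply: cvgB; first exact: crI.
    apply: cvgZl_tmp; apply: cvg_mulmx; last exact: cBhp.
    by apply/cvg_diag_mx/cvg_trmx; exact: cBhp.
  rewrite hrE.
  have dBhp : is_derive t 1 (fun t => B *m hp t) (B *m
      (pI_rhs kappa V G T Q lambda r (u t) (q t) (pI t) (rI t) (dI t)
       + lambda *: P t)).
    apply: is_derive_eq (is_derive_mulmx (is_derive_cst B t 1) (dhp t t0)) _.
    by rewrite mul0mx add0r.
  have dquad := is_derive_mulmx (is_derive_diag_mx (is_derive_trmx dBhp)) dBhp.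
  apply: is_derive_eq (is_deriveB_fun (is_deriveB_fun (drI t t0)
    (is_deriveZ_fun (2 * lambda)^-1 dquad))
    (is_derive_cst (r_unknown kappa r) t 1)) _.
  (* The product rule on [diag (B p_hat) (B p_hat)] yields the same vector twice, which explains the
     factor [2] in [ru_hat]. *)
  have half (w : 'cV[R]_s) : (2 * lambda)^-1 *: (w + w) = lambda^-1 *: w.
    rewrite -[w + w]mulr2n -[w *+ 2]scaler_nat scalerA; congr (_ *: _).
    by field.
  rewrite subr0 [diag_mx (B *m (_ + _))^T *m _]mul_diag_mxC half.
  have -> : (Y t)^T = diag_mx (B *m hp t)^T *m B.
    by rewrite [LHS]trmx_mul tr_diag_mx trmxK.
  rewrite -(BE (q t)).
  exact: rI_rhs_error.
have ed_solves : solves (fun t => hd t - d)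
    (fun t => - (T (q t) *m (hp t - P t))).
  split=> [t|t t0].
    by apply: cvgB; [apply: cvgD; [exact: cdI|exact: cq]|exact: cvg_cst].
  apply: is_derive_eq (is_deriveB_fun (is_deriveD_fun (ddI t t0) (dq t t0))
    (is_derive_cst d t 1)) _.
  by rewrite subr0 mulmxBr opprB addrC.
have [bep ber bed] := errors_bounded lambda_gt0 r_ge0 ep_solves er_solves ed_solves.
have bhp_of : bounded_signal (fun t => T (q t)) -> bounded_signal p ->
    bounded_signal hp.
  move=> bT bp; rewrite (_ : hp = fun t => (hp t - P t) + P t); last first.
    by apply/funext => t; rewrite subrK.
  apply: bounded_signalD => //; apply: bounded_signal_mulmx => //.
  exact: bounded_signal_trmx.
have bhr : bounded_signal hr.
  rewrite (_ : hr = fun t => (hr t - r_unknown kappa r) + r_unknown kappa r).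
    by apply: bounded_signalD => //; exact: bounded_signal_cst.
  by apply/funext => t; rewrite subrK.
have bhd : bounded_signal hd.
  rewrite (_ : hd = fun t => (hd t - d) + d).
    by apply: bounded_signalD => //; exact: bounded_signal_cst.
  by apply/funext => t; rewrite subrK.
have bBhp : bounded_signal hp -> bounded_signal (fun t => B *m hp t).
  by move=> bhp; apply: bounded_signal_mulmx => //; exact: bounded_signal_cst.
split=> [//|bq bp|bT bTV bp].
  have bhp : bounded_signal hp by apply: bhp_of => //; exact: bounded_signal_comp.
  (* From [M^-1 = T T^T] one gets [T^-1 = T^T M], which shows that [T^-1] is continuous in [q]. *)
  have invTE x : invmx (T x) = (T x)^T *m M x.
    have MU : M x \in unitmx.
      by rewrite -unitmx_inv M_factor unitmx_mul unitmx_tr T_unit.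
    apply: (can_inj (mulKmx (T_unit x))).
    by rewrite mulmxV// mulmxA -M_factor mulVmx.
  split; split=> //.
  (* The observer states are recovered by solving the output formulas for [pI], [rI] and [dI]. *)
  - rewrite (_ : pI = fun t => hp t - lambda *: Q (q t)); last first.
      by apply/funext => t; rewrite /hp /p_hat addrK.
    by apply: bounded_signalB => //; apply/bounded_signalZ/bounded_signal_comp.
  - rewrite (_ : rI = fun t => hr t
        + (2 * lambda)^-1 *: (diag_mx (B *m hp t)^T *m (B *m hp t))); last first.
      by apply/funext => t; rewrite hrE subrK.
    apply: bounded_signalD => //; apply/bounded_signalZ/bounded_signal_mulmx.
      by apply/bounded_signal_diag_mx/bounded_signal_trmx/bBhp.
    exact: bBhp.
  - rewrite (_ : dI = fun t => hd t - q t); first exact: bounded_signalB.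
    by apply/funext => t; rewrite /hd /d_hat addrK.
  - apply: bounded_signal_mulmx => //; apply: bounded_signal_trmx.
    apply: (@bounded_signal_comp _ _ _ (fun x => invmx (T x))) => //.
    rewrite (funext invTE) => x.
    apply: (@cvg_mulmx _ _ _ _ _ (nbhs x) _ (fun y => (T y)^T) M).
      exact: (@cvg_trmx _ _ _ _ (nbhs x) _ T _ (T_cont x)).
    by apply/differentiable_continuous/smooth_differentiable.
have bhp := bhp_of bT bp.
have bY : bounded_signal Y.
  apply: bounded_signal_mulmx; first exact: bounded_signal_cst.
  by apply/bounded_signal_diag_mx/bounded_signal_trmx/bBhp.
have ep0 := error_cvg0 lambda_gt0 r_ge0 ep_solves er_solves ed_solves bT bY.
(* Since [T^-T P = p], the momentum error is the bounded factor [T^-T] times the vanishing error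
   [p_hat - P]. *)
rewrite (_ : (fun t => hbp t - p t) =
    fun t => (invmx (T (q t)))^T *m (hp t - P t)); last first.
  apply/funext => t; rewrite mulmxBr; congr (_ - _).
  by rewrite /P mulmxA -trmx_mul mulmxV// trmx1 mul1mx.
by apply: mulmx_cvg0 => //; exact: bounded_signal_trmx.
Qed.
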